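(* Let $K$ be a field and let $L=\sum_{r=1}^s I_{a_r}J_{b_r}\subset K[x_1,\dots,x_n,y_1,\dots,y_m]$, where the ideals $I_{a_r}$ in $K[x_1,\dots,x_n]$ and the ideals $J_{b_r}$ in $K[y_1,\dots,y_m]$ are squarefree Veronese ideals of degree $a_r$ and $b_r$, respectively. Assume that $0\le a_1<\dots<a_s\le n$, $m\ge b_1>\dots>b_s\ge 0$, and that there is an integer $h$ with $a_r+b_r=h$ for all $r=1,\dots,s$. If $a_{r+1}=a_r+1$ for all $r=1,\dots,s-1$ and $b_{r-1}=b_r+1$ for all $r=2,\dots,s$, then $L$ is normal.
   Context: The squarefree Veronese ideal $I_a$ of degree $a$ in $K[x_1,\dots,x_n]$ is generated by all squarefree monomials of degree $a$ in $x_1,\dots,x_n$ (so $I_0$ is the unit ideal); $J_b$ is defined likewise in $K[y_1,\dots,y_m]$. Sums and products are formed in $K[x_1,\dots,x_n,y_1,\dots,y_m]$ after extending the ideals to that ring. The integral closure $\overline{I}$ of an ideal $I$ in a ring $R$ is the set of $f\in R$ satisfying an equation $f^k+c_1f^{k-1}+\dots+c_{k-1}f+c_k=0$ for some $k\ge 1$ with $c_i\in I^i$ for all $i$. The ideal $I$ is integrally closed if $I=\overline{I}$, and normal if all powers $I^k$, $k\ge 1$, are integrally closed. *)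

(* Defs.v *)
From HB Require Import structures.
From mathcomp Require Import all_boot all_order all_algebra.
From mathcomp Require Import mpoly.

Set Implicit Arguments.
Unset Strict Implicit.
Unset Printing Implicit Defensive.

Import GRing.Theory.
Local Open Scope ring_scope.

(* Ideals are Prop-valued predicates: membership in an ideal of an arbitrary
   commutative ring is not decidable, so the boolean ideal predicates of
   ring_quotient do not apply. *)
Section Ideals.
Context {R : comNzRingType}.
Implicit Types (S I J : R -> Prop).

Definition ideal_gen S : R -> Prop := fun f =>
  exists (k : nat) (c g : 'I_k -> R),
    (forall i, S (g i)) /\ f = \sum_(i < k) c i * g i.

Definition ideal_sum (s : nat) (I : 'I_s -> R -> Prop) : R -> Prop := fun f =>
  exists g : 'I_s -> R, (forall r, I r (g r)) /\ f = \sum_(r < s) g r.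

Definition ideal_mul I J : R -> Prop :=
  ideal_gen (fun f => exists g h, [/\ I g, J h & f = g * h]).

Fixpoint ideal_pow I (k : nat) : R -> Prop :=
  if k is k'.+1 then ideal_mul I (ideal_pow I k') else fun=> True.

Definition integral_closure I : R -> Prop := fun f =>
  exists (k : nat) (c : nat -> R),
    [/\ (1 <= k)%N,
        forall i, (1 <= i <= k)%N -> ideal_pow I i (c i)
      & f ^+ k + \sum_(1 <= i < k.+1) c i * f ^+ (k - i) = 0].

Definition integrally_closed I : Prop :=
  forall f, I f <-> integral_closure I f.

Definition normal_ideal I : Prop :=
  forall k, (1 <= k)%N -> integrally_closed (ideal_pow I k).

End Ideals.

Definition ideal_ext (A B : comNzRingType) (phi : {rmorphism A -> B})
    (I : A -> Prop) : B -> Prop :=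
  ideal_gen (fun f => exists2 g, I g & f = phi g).

Definition squarefree_monomial (n : nat) (u : 'X_{1..n}) : Prop :=
  forall i : 'I_n, (u i <= 1)%N.

Definition sqfree_veronese (K : fieldType) (n a : nat) : {mpoly K[n]} -> Prop :=
  ideal_gen (fun f => exists u : 'X_{1..n},
    [/\ squarefree_monomial u, mdeg u = a & f = 'X_[u]]).

(* K[x_1..x_n, y_1..y_m] is {mpoly K[n + m]}: the first n variables are the
   x_i and the last m are the y_j. *)
Definition incl_x (K : fieldType) (n m : nat) :
    {rmorphism {mpoly K[n]} -> {mpoly K[n + m]}} :=
  comp_mpoly [tuple 'X_(lshift m i) | i < n].

Definition incl_y (K : fieldType) (n m : nat) :
    {rmorphism {mpoly K[m]} -> {mpoly K[n + m]}} :=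
  comp_mpoly [tuple 'X_(rshift n j) | j < m].

(* Main.v *)
Require Import Defs.
From mathcomp Require Import all_boot all_order all_algebra.
From mathcomp Require Import mpoly.
From mathcomp Require Import zify.

(** Write L for the sum of the products of squarefree Veronese ideals, A and B for the
least and greatest a_r, X and Y for the two groups of variables.  Since the a_r
are consecutive, L is generated by the squarefree monomials of degree h whose
X-degree lies in [A, B].  One inclusion, L^k in its integral closure, is
formal.  For the other one, the monomials of an f integral over L^k are shown
to lie in L^k, in two steps.

Valuations.  For a set T of variables, the T-weight of a monomial is its degree
in the variables of T, and the least T-weight of the monomials of a polynomial
is a valuation.  So if every element of L has T-order at least c, then f has
T-order at least kc ([order_ge_ideal_pow], [order_ge_integral_closure]).  For
L the constant c comes from the fact that a squarefree monomial of degree d has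
degree at least d - |complement of T| in the variables of T
([squarefree_weight], [veronese_sum_order]).

Combinatorics.  Let u be a monomial of f, and cap its exponents at k.  Taking
for T the set of variables of X, of Y, or of both, whose exponent in u is at
most k, the valuations say exactly that the capped exponents have X-sum at
least kA, Y-sum at least k(h - B) and total at least kh.  These
three inequalities suffice for u to be divisible by a product of k of the
squarefree generators ([sum_of_bases]).  That product is found without any
exchange argument: choose a divisor of degree kh of the capped monomial, with
X-degree in [kA, kB], list its kh variables in order, X first, and deal
them out cyclically to k players.  A variable occurs at most k times in a row,
so every hand is squarefree; every hand has h variables; and the X-degrees of
the hands are the floor or the ceiling of the average, so they lie in
[A, B]. *)

Set Implicit Arguments.
Unset Strict Implicit.
Unset Printing Implicit Defensive.

Import GRing.Theory.
Local Open Scope ring_scope.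

(** * Ideals and their powers *)

Section IdealTheory.
Context {R : comNzRingType}.
Implicit Types (S I J P : R -> Prop).

Record is_ideal P : Prop := IsIdeal {
  is_ideal0 : P 0;
  is_idealD : forall f g, P f -> P g -> P (f + g);
  is_idealMl : forall c f, P f -> P (c * f) }.

Lemma is_ideal_sum P (T : Type) (r : seq T) (Q : pred T) (F : T -> R) :
  is_ideal P -> (forall i, Q i -> P (F i)) -> P (\sum_(i <- r | Q i) F i).
Proof. by case=> P0 PD _ PF; elim/big_rec: _ => // i x /PF; apply: PD. Qed.

Lemma ideal_gen_is_ideal S : is_ideal (ideal_gen S).
Proof.
split=> [|f g [k [c [x [Sx ->]]]] [l [d [y [Sy ->]]]]|d f [k [c [x [Sx ->]]]]].
- by exists 0%N, (fun=> 0), (fun=> 0); split=> [[]|] //; rewrite big_ord0.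
- exists (k + l)%N,
    (fun i => match split i with inl i => c i | inr i => d i end),
    (fun i => match split i with inl i => x i | inr i => y i end).
  split=> [i|]; first by case: splitP.
  rewrite big_split_ord; congr (_ + _); apply: eq_bigr => i _.
    by rewrite (unsplitK (inl i)).
  by rewrite (unsplitK (inr i)).
- exists k, (fun i => d * c i), x; split=> //.
  by rewrite mulr_sumr; apply: eq_bigr => i _; rewrite mulrA.
Qed.

Lemma sub_ideal_gen S f : S f -> ideal_gen S f.
Proof.
by move=> Sf; exists 1%N, (fun=> 1), (fun=> f); split; rewrite // big_ord1 mul1r.
Qed.

Lemma ideal_gen_min S P :
  is_ideal P -> (forall f, S f -> P f) -> forall f, ideal_gen S f -> P f.
Proof.
move=> idP SP f [k [c [g [Sg ->]]]]; apply: is_ideal_sum => // i _.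
by apply: is_idealMl => //; apply: SP.
Qed.

Lemma ideal_pow_is_ideal I k : is_ideal (ideal_pow I k).
Proof. by case: k => [|k] //; apply: ideal_gen_is_ideal. Qed.

Lemma prod_ideal_pow I k (g : 'I_k -> R) :
  (forall j, I (g j)) -> ideal_pow I k (\prod_(j < k) g j).
Proof.
elim: k g => [|k IH] g Ig //; rewrite big_ord_recl; apply: sub_ideal_gen.
by exists (g ord0), (\prod_(j < k) g (lift ord0 j)); split=> //; apply: IH.
Qed.

(** An element f of J is a root of the monic polynomial t - f. *)
Lemma sub_integral_closure J f : J f -> integral_closure J f.
Proof.
move=> Jf; exists 1%N, (fun=> - f); split=> // [i|]; last first.
  by rewrite big_nat1 subnn expr0 expr1 mulr1 subrr.
move=> i1; have ->: i = 1%N by lia.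
rewrite -mulN1r; apply: is_idealMl; first exact: ideal_pow_is_ideal.
by apply: sub_ideal_gen; exists f, 1; rewrite mulr1.
Qed.

End IdealTheory.

(** * Supports of polynomials *)

Section Support.
Context {N : nat} {K : fieldType}.
Implicit Types (P Q : 'X_{1..N} -> Prop) (f g : {mpoly K[N]}).

Definition supported P f := forall u, u \in msupp f -> P u.

Lemma supported0 P : supported P 0.
Proof. by move=> u; rewrite msupp0. Qed.

Lemma supportedD P f g : supported P f -> supported P g -> supported P (f + g).
Proof. by move=> Pf Pg u /msuppD_le; rewrite mem_cat => /orP[/Pf|/Pg]. Qed.

Lemma supportedN P f : supported P f -> supported P (- f).
Proof. by move=> Pf u; rewrite (perm_mem (msuppN f)) => /Pf. Qed.

Lemma supportedM P Q (PQ : 'X_{1..N} -> Prop) f g :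
  (forall u v, P u -> Q v -> PQ (u + v)%MM) ->
  supported P f -> supported Q g -> supported PQ (f * g).
Proof.
by move=> PQuv Pf Qg u /msuppM_le /allpairsP[[v w] /= [/Pf Pv /Qg Qw ->]]; apply: PQuv.
Qed.

Lemma supportedX P u : P u -> supported P 'X_[u].
Proof. by move=> Pu v; rewrite msuppX inE => /eqP->. Qed.

(** The part of f supported on P isolates its lowest weight component when P is
a bound on the weight. *)
Lemma mpoly_supported_split (P : pred 'X_{1..N}) f :
  exists g, supported P g /\ supported (fun u => ~~ P u /\ u \in msupp f) (f - g).
Proof.
exists (\sum_(u <- msupp f | P u) f@_u *: 'X_[u]).
have key (Q : pred 'X_{1..N}) : supported (fun u => Q u /\ u \in msupp f)
    (\sum_(u <- msupp f | Q u) f@_u *: 'X_[u]).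
  rewrite -big_filter big_seq => v.
  elim/big_rec: _ v => [|u x]; first exact: supported0.
  rewrite mem_filter => /andP[Qu uf]; apply: supportedD => v /msuppZ_le.
  by rewrite msuppX inE => /eqP->.
split; first by move=> u /key[].
set g := (\sum_(u <- _ | _) _).
have -> : f - g = \sum_(u <- msupp f | ~~ P u) f@_u *: 'X_[u].
  by apply/eqP; rewrite subr_eq addrC [X in X == _]mpolyE (bigID P).
exact: key.
Qed.

End Support.

(** * Monomial valuations and integral closure *)

Section Weight.
Context {N : nat} {K : fieldType} (T : pred 'I_N).
Implicit Types (f g : {mpoly K[N]}) (I : {mpoly K[N]} -> Prop).

Definition weight (u : 'X_{1..N}) := (\sum_(i | T i) u i)%N.

Lemma weightD u v : weight (u + v)%MM = (weight u + weight v)%N.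
Proof. by rewrite /weight -big_split; apply: eq_bigr => i _; rewrite mnmDE. Qed.

Definition order_ge c f := supported (fun u => c <= weight u)%N f.

Lemma order_geM c d f g :
  order_ge c f -> order_ge d g -> order_ge (c + d) (f * g).
Proof. by apply: supportedM => u v; rewrite weightD; apply: leq_add. Qed.

Lemma order_geW c d f : (c <= d)%N -> order_ge d f -> order_ge c f.
Proof. by move=> cd fd u /fd; apply: leq_trans. Qed.

Lemma order_geX c f k : order_ge c f -> order_ge (k * c) (f ^+ k).
Proof.
move=> cf; elim: k => [|k IH]; first by move=> u _; rewrite mul0n.
by rewrite exprS mulSn; apply: order_geM.
Qed.

Lemma order_ge_is_ideal c : is_ideal (order_ge c).
Proof.
split=> [|f g|d f cf]; [exact: supported0 | exact: supportedD |].
by rewrite -[c]add0n; apply: order_geM.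
Qed.

Lemma order_ge_ideal_pow I c k :
  (forall f, I f -> order_ge c f) ->
  forall f, ideal_pow I k f -> order_ge (k * c) f.
Proof.
move=> Ic; elim: k => [|k IH] f; first by move=> _ u _; rewrite mul0n.
apply: ideal_gen_min; first exact: order_ge_is_ideal.
by move=> _ [g [h [Ig Ih ->]]]; rewrite mulSn; apply: order_geM; auto.
Qed.

(** The order is a valuation, and valuation ideals are integrally closed.  The
bound d on the order of f is raised one unit at a time: for d < c, each
term a_i f^(k-i) of the equation of f has order at least ic + (k-i)d > kd,
hence so has f^k.  If g is the component of f of weight d, then f^k - g^k has
order > kd too, hence so has g^k; as g^k is homogeneous of weight kd, it
vanishes, and so does g because polynomials form a domain. *)
Lemma order_ge_integral_closure I c :
  (forall f, I f -> order_ge c f) ->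
  forall f, integral_closure I f -> order_ge c f.
Proof.
move=> Ic f [k [a [k1 aI eqf]]].
suff key d : (d <= c)%N -> order_ge d f by exact: key.
elim: d => [|d IH] dc; first by move=> u.
have df : order_ge d f by apply: IH; lia.
have [g [gd rest]] := mpoly_supported_split (fun u => weight u <= d)%N f.
have rd : order_ge d.+1 (f - g).
  by move=> u /rest[]; lia.
suff g0 : g = 0 by move: rd; rewrite g0 subr0.
have gd' : order_ge d g.
  have -> : g = f - (f - g) by rewrite subKr.
  apply: supportedD => //; apply: supportedN; apply: order_geW rd; lia.
have fk : order_ge (k * d).+1 (f ^+ k).
  have -> : f ^+ k = - \sum_(1 <= i < k.+1) a i * f ^+ (k - i).
    by apply/eqP; rewrite -addr_eq0 eqf.
  apply: supportedN; rewrite big_nat; apply: is_ideal_sum => [|i i1k].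
    exact: order_ge_is_ideal.
  apply: (@order_geW _ (i * c + (k - i) * d)); first nia.
  apply: order_geM; last exact: order_geX.
  by apply: order_ge_ideal_pow Ic _ _; apply: aI; lia.
have fgk j : order_ge (j * d).+1 (f ^+ j - g ^+ j).
  elim: j => [|j IHj]; first by rewrite !expr0 subrr; apply: supported0.
  have -> : f ^+ j.+1 - g ^+ j.+1 = f * (f ^+ j - g ^+ j) + (f - g) * g ^+ j.
    by rewrite mulrBr mulrBl -!exprS addrA subrK.
  apply: supportedD.
    by apply: (order_geW _ (order_geM df IHj)); lia.
  by apply: (order_geW _ (order_geM rd (@order_geX _ _ j gd'))); lia.
have gk_ge : order_ge (k * d).+1 (g ^+ k).
  have -> : g ^+ k = f ^+ k - (f ^+ k - g ^+ k) by rewrite subKr.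
  by apply: supportedD => //; apply: supportedN; apply: fgk.
have gk_le j : supported (fun u => weight u <= j * d)%N (g ^+ j).
  elim: j => [|j IHj].
    rewrite expr0 => u; rewrite msupp1 inE => /eqP->.
    by rewrite /weight big1 // => i; rewrite mnmE.
  by rewrite exprS mulSn; apply: supportedM gd IHj => u v; rewrite weightD; lia.
have /eqP : g ^+ k = 0.
  apply: msuppnil0; case E : (msupp _) => [//|u s].
  have uk : u \in msupp (g ^+ k) by rewrite E mem_head.
  by have := gk_le _ _ uk; have := gk_ge _ uk; lia.
by rewrite expf_eq0 => /andP[_ /eqP].
Qed.

End Weight.

(** * Dealing out a monomial into squarefree ones *)

Section Combinatorics.
Local Open Scope nat_scope.

(** Hermite's identity: raising t by one replaces the term t / k by
(t + k) / k = t / k + 1 and shifts the other ones. *)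
Lemma hermite_divn k t : 0 < k -> \sum_(j < k) (t + j) %/ k = t.
Proof.
move=> k0; elim: t => [|t IH].
  by apply: big1 => j _; rewrite add0n divn_small.
rewrite -{2}IH; case: k k0 {IH} => // k _.
rewrite [LHS]big_ord_recr [in RHS]big_ord_recl /=.
rewrite addSnnS divnDr ?dvdnn // divnn addn0.
under eq_bigr => j _ do rewrite addSnnS.
by rewrite addnA [X in X + _]addnC addn1.
Qed.

Section Slices.
Variables (N : nat) (v : 'I_N -> nat).

Definition prefix_sum t := \sum_(j < N | j < t) v j.

Lemma prefix_sum0 : prefix_sum 0 = 0.
Proof. by rewrite /prefix_sum big_pred0. Qed.

Lemma prefix_sumS (i : 'I_N) : prefix_sum i.+1 = prefix_sum i + v i.
Proof.
rewrite /prefix_sum (bigD1 i) //= addnC; congr (_ + _).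
by apply: eq_bigl => j; rewrite -val_eqE /=; lia.
Qed.

Lemma leq_prefix_sum : {homo prefix_sum : s t / s <= t}.
Proof.
move=> s t st; rewrite /prefix_sum [leqLHS]big_mkcond [leqRHS]big_mkcond.
by apply: leq_sum => j _; do 2! case: ifP; lia.
Qed.

(** The variables of the monomial v are listed in order, each repeated
according to its exponent, and F t counts those among the first t entries of
the list that are kept.  Degrees of a slice over initial segments of variables
then telescope. *)
Definition slice (F : nat -> nat) : 'X_{1..N} :=
  [multinom F (prefix_sum i.+1) - F (prefix_sum i) | i < N].

End Slices.

Definition xdeg n m (u : 'X_{1..n + m}) := \sum_(i < n) u (lshift m i).
Definition ydeg n m (u : 'X_{1..n + m}) := \sum_(i < m) u (rshift n i).

Lemma mdegDxy n m (u : 'X_{1..n + m}) : mdeg u = xdeg u + ydeg u.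
Proof. by rewrite mdegE big_split_ord. Qed.

Lemma xdeg_slice n m (v : 'I_(n + m) -> nat) F :
  {homo F : s t / s <= t} ->
  xdeg (slice v F) = F (\sum_(i < n) v (lshift m i)) - F 0.
Proof.
move=> homoF; rewrite /xdeg -{3}(prefix_sum0 v).
have -> : \sum_(i < n) v (lshift m i) = prefix_sum v n.
  rewrite /prefix_sum big_split_ord /= [X in _ = _ + X]big_pred0 => [|i]; last by lia.
  by rewrite addn0; apply: eq_bigl => i; rewrite ltn_ord.
rewrite -(@telescope_sumn 0 n (fun i => F (prefix_sum v i))).
  by rewrite big_mkord; apply: eq_bigr => i _; rewrite mnmE.
by move=> s t st; apply/homoF/leq_prefix_sum.
Qed.

Lemma mdeg_slice N (v : 'I_N -> nat) F :
  {homo F : s t / s <= t} -> mdeg (slice v F) = F (\sum_(i < N) v i) - F 0.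
Proof.
move=> homoF; rewrite mdegE -{3}(prefix_sum0 v).
have -> : \sum_(i < N) v i = prefix_sum v N.
  by apply: eq_bigl => i; rewrite ltn_ord.
rewrite -(@telescope_sumn 0 N (fun i => F (prefix_sum v i))).
  by rewrite big_mkord; apply: eq_bigr => i _; rewrite mnmE.
by move=> s t st; apply/homoF/leq_prefix_sum.
Qed.

(** G t counts the entries kept among the first t when the list of the capped
variables is cut down to its first p X-entries and its first q Y-entries.
F j t = (G t + j) / k counts those of them that are dealt to player j, as it
jumps once in every k steps.  The hands add up to a divisor of u by Hermite's
identity. *)
Lemma sum_of_bases n m k h A B (u : 'X_{1..n + m})
    (X := \sum_(i < n) minn (u (lshift m i)) k)
    (Y := \sum_(i < m) minn (u (rshift n i)) k) :
  0 < k -> A <= B -> k * A <= X -> k * h <= Y + k * B -> k * h <= X + Y ->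
  A <= h ->
  exists e : 'I_k -> 'X_{1..n + m},
    [/\ forall j, squarefree_monomial (e j), forall j, A <= xdeg (e j) <= B,
        forall j, mdeg (e j) = h & (\big[mnm_add/mnm0]_j e j <= u)%MM].
Proof.
move=> k0 AB XA YB XY Ah.
(* p is the least X-degree compatible with both p >= kA and kh - p <= Y. *)
pose p := maxn (k * A) (k * h - Y); pose q := k * h - p.
have [pX qY pq] : [/\ p <= X, q <= Y & p + q = k * h] by split; nia.
have [pA pB] : k * A <= p /\ p <= k * B by split; nia.
pose G t := minn t p + minn (t - X) q.
have Ghomo : {homo G : s t / s <= t} by move=> s t; rewrite /G; lia.
have GX : G X = p by rewrite /G; lia.
have GXY : G (X + Y) = k * h by rewrite /G; lia.
pose v (i : 'I_(n + m)) := minn (u i) k.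
have GS (i : 'I_(n + m)) : G (prefix_sum v i.+1) - G (prefix_sum v i) <= v i.
  by rewrite prefix_sumS /G; lia.
pose F j t := (G t + j) %/ k.
have Fhomo j : {homo F j : s t / s <= t}.
  by move=> s t /Ghomo st; rewrite /F leq_div2r // leq_add2r.
have F0 (j : 'I_k) : F j 0 = 0
  by rewrite /F /G divn_small //; have := ltn_ord j; lia.
exists (fun j => slice v (F j)); split=> [j i|j|j|].
- have GSk : G (prefix_sum v i.+1) + j <= G (prefix_sum v i) + j + k.
    by have := GS i; rewrite /v; lia.
  rewrite mnmE leq_subLR /F; apply: leq_trans (leq_div2r k GSk) _.
  by rewrite divnDr ?dvdnn // divnn k0 addnC.
- rewrite xdeg_slice // F0 subn0 /F -/X GX.
  rewrite leq_divRL // -[_ <= B]ltnS ltn_divLR //; have := ltn_ord j; nia.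
- rewrite mdeg_slice // F0 subn0 big_split_ord /F -/X -/Y GXY.
  by rewrite divnDl ?dvdn_mulr // mulKn // divn_small ?addn0.
- apply/mnm_lepP => i; rewrite mnm_sumE.
  under eq_bigr => j _ do rewrite mnmE.
  rewrite sumnB => [|j _]; last by apply/Fhomo/leq_prefix_sum.
  by rewrite !hermite_divn //; apply: leq_trans (GS i) (geq_minl _ _).
Qed.

End Combinatorics.

(** * The generators of the two Veronese ideals in the common ring *)

Section Embeddings.
Variables (K : fieldType) (n m : nat).

Definition xext (u : 'X_{1..n}) : 'X_{1..n + m} :=
  [multinom if split i is inl j then u j else 0%N | i < n + m].
Definition yext (u : 'X_{1..m}) : 'X_{1..n + m} :=
  [multinom if split i is inr j then u j else 0%N | i < n + m].

Lemma split_lshift i : split (lshift m i) = inl i :> 'I_n + 'I_m.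
Proof. exact: (unsplitK (inl i)). Qed.

Lemma split_rshift i : split (rshift n i) = inr i :> 'I_n + 'I_m.
Proof. exact: (unsplitK (inr i)). Qed.

Lemma incl_xX u : incl_x K n m 'X_[u] = 'X_[xext u].
Proof.
rewrite [LHS]comp_mpolyX [RHS]mpolyXE_id big_split_ord /=.
rewrite [X in _ = _ * X]big1 ?mulr1 => [|i _]; last by rewrite mnmE split_rshift.
by apply: eq_bigr => i _; rewrite tnth_mktuple mnmE split_lshift.
Qed.

Lemma incl_yX u : incl_y K n m 'X_[u] = 'X_[yext u].
Proof.
rewrite [LHS]comp_mpolyX [RHS]mpolyXE_id big_split_ord /=.
rewrite [X in _ = X * _]big1 ?mul1r => [|i _]; last by rewrite mnmE split_lshift.
by apply: eq_bigr => i _; rewrite tnth_mktuple mnmE split_rshift.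
Qed.

Lemma weight_xext (T : pred 'I_(n + m)) u :
  weight T (xext u) = weight (fun i => T (lshift m i)) u.
Proof.
rewrite /weight big_split_ord /= [X in (_ + X)%N]big1 ?addn0 => [|i _].
  by apply: eq_bigr => i _; rewrite mnmE split_lshift.
by rewrite mnmE split_rshift.
Qed.

Lemma weight_yext (T : pred 'I_(n + m)) u :
  weight T (yext u) = weight (fun i => T (rshift n i)) u.
Proof.
rewrite /weight big_split_ord /= [X in (X + _)%N]big1 ?add0n => [|i _].
  by apply: eq_bigr => i _; rewrite mnmE split_rshift.
by rewrite mnmE split_lshift.
Qed.

Lemma xext_yext (u : 'X_{1..n + m}) :
  u = (xext [multinom u (lshift m i) | i < n] +
       yext [multinom u (rshift n i) | i < m])%MM.
Proof.
apply/mnmP => i; rewrite mnmDE !mnmE -{1}(splitK i).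
by case: (split i) => j /=; rewrite mnmE ?addn0.
Qed.

End Embeddings.

(** A squarefree monomial has exponent at most 1 at each variable outside T. *)
Lemma squarefree_weight N (T : pred 'I_N) (u : 'X_{1..N}) :
  squarefree_monomial u -> (mdeg u - \sum_(i < N) ~~ T i <= weight T u)%N.
Proof.
move=> sq; rewrite leq_subLR mdegE /weight [X in (_ <= _ + X)%N]big_mkcond.
rewrite -big_split leq_sum // => i _.
by have := sq i; case: (T i) => /=; lia.
Qed.

Lemma is_ideal_comp (A B : comNzRingType) (phi : {rmorphism A -> B})
    (P : B -> Prop) : is_ideal P -> is_ideal (fun f => P (phi f)).
Proof.
case=> P0 PD PM; split=> [|f g|c f]; first by rewrite rmorph0.
  by rewrite rmorphD; apply: PD.
by rewrite rmorphM; apply: PM.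
Qed.

Section Bounds.
Variables (K : fieldType) (n m : nat).
Variable T : pred 'I_(n + m).

Lemma veronese_x_order a f :
  ideal_ext (incl_x K n m) (@sqfree_veronese K n a) f ->
  order_ge T (a - \sum_(i < n) ~~ T (lshift m i)) f.
Proof.
have idW := @order_ge_is_ideal _ K T (a - \sum_(i < n) ~~ T (lshift m i)).
apply: (ideal_gen_min idW) => _ [g Ig ->]; move: g Ig.
apply: (ideal_gen_min (is_ideal_comp _ idW)) => _ [u [squ <- ->]].
rewrite incl_xX; apply: supportedX; rewrite weight_xext.
exact: squarefree_weight.
Qed.

Lemma veronese_y_order b f :
  ideal_ext (incl_y K n m) (@sqfree_veronese K m b) f ->
  order_ge T (b - \sum_(i < m) ~~ T (rshift n i)) f.
Proof.
have idW := @order_ge_is_ideal _ K T (b - \sum_(i < m) ~~ T (rshift n i)).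
apply: (ideal_gen_min idW) => _ [g Ig ->]; move: g Ig.
apply: (ideal_gen_min (is_ideal_comp _ idW)) => _ [u [squ <- ->]].
rewrite incl_yX; apply: supportedX; rewrite weight_yext.
exact: squarefree_weight.
Qed.

End Bounds.

(** * The sum of products of Veronese ideals *)

Section VeroneseSum.
Variables (K : fieldType) (n m s : nat) (a b : 'I_s -> nat).

Definition veronese_sum : {mpoly K[n + m]} -> Prop :=
  ideal_sum (fun r : 'I_s =>
       ideal_mul (ideal_ext (incl_x K n m) (@sqfree_veronese K n (a r)))
                 (ideal_ext (incl_y K n m) (@sqfree_veronese K m (b r)))).

Lemma veronese_sum_order (T : pred 'I_(n + m)) c f :
  (forall r, c <= (a r - \sum_(i < n) ~~ T (lshift m i))
                + (b r - \sum_(i < m) ~~ T (rshift n i)))%N ->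
  veronese_sum f -> order_ge T c f.
Proof.
move=> cab [g [Lg ->]]; apply: is_ideal_sum => [|r _].
  exact: order_ge_is_ideal.
apply: ideal_gen_min (Lg r); first exact: order_ge_is_ideal.
move=> _ [x [y [Ix Jy ->]]]; apply: order_geW (cab r) _.
by apply: order_geM; [apply: veronese_x_order | apply: veronese_y_order].
Qed.

Lemma monomial_veronese_sum r (u : 'X_{1..n + m}) :
  squarefree_monomial u -> xdeg u = a r -> ydeg u = b r ->
  veronese_sum 'X_[u].
Proof.
move=> squ xu yu.
exists (fun r' => if r' == r then 'X_[u] else 0); split=> [r'|]; last first.
  by rewrite -big_mkcond big_pred1_eq.
case: eqP => [->|_]; last exact: is_ideal0 (ideal_gen_is_ideal _).
apply: sub_ideal_gen; rewrite [u]xext_yext mpolyXD -incl_xX -incl_yX.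
eexists _, _; split; last reflexivity; apply: sub_ideal_gen.
  eexists; last reflexivity.
  apply: sub_ideal_gen; eexists; split; last reflexivity.
    by move=> i; rewrite mnmE.
  by rewrite mdegE -xu; apply: eq_bigr => i _; rewrite mnmE.
eexists; last reflexivity.
apply: sub_ideal_gen; eexists; split; last reflexivity.
  by move=> i; rewrite mnmE.
by rewrite mdegE -yu; apply: eq_bigr => i _; rewrite mnmE.
Qed.

End VeroneseSum.

(** * Normality *)

Lemma consecutive_ord s (a : 'I_s.+1 -> nat) :
  (forall r r' : 'I_s.+1, nat_of_ord r' = r.+1 -> a r' = (a r).+1) ->
  forall r, a r = (a ord0 + r)%N.
Proof.
move=> a_step [r]; elim: r => [|r IH] lt_r.
  by rewrite addn0; congr a; apply: val_inj.
by rewrite (a_step (Ordinal (ltnW lt_r))) // IH addnS.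
Qed.

Lemma ideal_of_monomials N (K : fieldType) (P : {mpoly K[N]} -> Prop) f :
  is_ideal P -> (forall u, u \in msupp f -> P 'X_[u]) -> P f.
Proof.
move=> idP PX; rewrite [f]mpolyE big_seq; apply: is_ideal_sum => // u uf.
by rewrite -mul_mpolyC; apply: is_idealMl => //; apply: PX.
Qed.

Lemma monomial_ideal_pow N (K : fieldType) (I : {mpoly K[N]} -> Prop) k
    (e : 'I_k -> 'X_{1..N}) (u : 'X_{1..N}) :
  (forall j, I 'X_[e j]) -> (\big[mnm_add/mnm0]_j e j <= u)%MM ->
  ideal_pow I k 'X_[u].
Proof.
move=> Ie /submK <-; rewrite mpolyXD; apply: is_idealMl.
  exact: ideal_pow_is_ideal.
by rewrite -mprodXE; apply: prod_ideal_pow.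
Qed.

(** This turns a lower bound on the weight for the set of variables of exponent
at most k into a lower bound on the capped degree: a variable outside the set
contributes k. *)
Lemma sum_minn N (u : 'I_N -> nat) k :
  (\sum_(i < N) minn (u i) k =
   \sum_(i < N | u i <= k) u i + k * \sum_(i < N) ~~ (u i <= k))%N.
Proof.
rewrite big_distrr [X in (X + _)%N]big_mkcond -big_split /=.
by apply: eq_bigr => i _; case: leqP; lia.
Qed.

Theorem theorem2p12 (K : fieldType) (n m s : nat) (a b : 'I_s -> nat) (h : nat)
    (a_incr : forall r r' : 'I_s, (r < r')%N -> (a r < a r')%N)
    (a_le : forall r : 'I_s, (a r <= n)%N)
    (b_decr : forall r r' : 'I_s, (r < r')%N -> (b r' < b r)%N)
    (b_le : forall r : 'I_s, (b r <= m)%N)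
    (ab_sum : forall r : 'I_s, (a r + b r)%N = h)
    (a_step : forall r r' : 'I_s, nat_of_ord r' = r.+1 -> a r' = (a r).+1)
    (b_step : forall r r' : 'I_s, nat_of_ord r' = r.+1 -> b r = (b r').+1) :
  normal_ideal
    (ideal_sum (fun r : 'I_s =>
       ideal_mul (ideal_ext (incl_x K n m) (@sqfree_veronese K n (a r)))
                 (ideal_ext (incl_y K n m) (@sqfree_veronese K m (b r))))).
Proof.
rewrite -/(veronese_sum _ _) => k k1 f.
split=> [|clf]; first exact: sub_integral_closure.
apply: ideal_of_monomials => [|u uf]; first exact: ideal_pow_is_ideal.
have bound (Tx : pred 'I_n) (Ty : pred 'I_m) c :
    (forall r, c <= (a r - \sum_(i < n) ~~ Tx i)
                  + (b r - \sum_(i < m) ~~ Ty i))%N ->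
    (k * c <= \sum_(i < n | Tx i) u (lshift m i)
            + \sum_(i < m | Ty i) u (rshift n i))%N.
  pose T i := match split i with inl j => Tx j | inr j => Ty j end.
  have Tl i : T (lshift m i) = Tx i by rewrite /T split_lshift.
  have Tr i : T (rshift n i) = Ty i by rewrite /T split_rshift.
  move=> cab; have : order_ge T (k * c) f.
    apply: order_ge_integral_closure clf => g.
    apply: order_ge_ideal_pow => {}g; apply: veronese_sum_order => r.
    under eq_bigr do rewrite Tl; under [X in (_ + (_ - X))%N]eq_bigr do rewrite Tr.
    exact: cab.
  move=> /(_ u uf); rewrite /weight big_split_ord /=.
  by rewrite (eq_bigl _ _ Tl) (eq_bigl _ _ Tr).
case: s a b a_incr a_le b_decr b_le ab_sum a_step b_step clf bound
  => [|s] a b _ a_le _ b_le ab_sum a_step _ _ bound.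
  (* The ideal is zero and the bound holds for every c, so f has no monomials. *)
  have : (k * (mdeg u).+1 <= mdeg u)%N.
    by rewrite [leqRHS]mdegDxy; apply: (bound xpredT xpredT); case.
  by nia.
have aE := consecutive_ord a_step.
pose A := a ord0; pose B := a ord_max.
have [AB Ah] : (A <= B /\ A <= h)%N.
  by rewrite -(ab_sum ord0) /B (aE ord_max) !leq_addr.
have a_bnd r : (A <= a r <= B)%N.
  by rewrite /A /B (aE r) (aE ord_max) leq_addr leq_add2l -ltnS ltn_ord.
pose Tx (i : 'I_n) := (u (lshift m i) <= k)%N.
pose Ty (i : 'I_m) := (u (rshift n i) <= k)%N.
(* The three valuations that u has to satisfy, for T inside X, T inside Y, and T
   meeting both. *)
pose x_missing := (\sum_(i < n) ~~ Tx i)%N.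
pose y_missing := (\sum_(i < m) ~~ Ty i)%N.
pose x_small := (\sum_(i < n | Tx i) u (lshift m i))%N.
pose y_small := (\sum_(i < m | Ty i) u (rshift n i))%N.
have x_bound : (k * (A - x_missing) <= x_small)%N.
  have := bound Tx xpred0 (A - x_missing)%N; rewrite big_pred0_eq addn0; apply.
  by move=> r; have := a_bnd r; rewrite -/x_missing; lia.
have y_bound : (k * (h - B - y_missing) <= y_small)%N.
  have := bound xpred0 Ty (h - B - y_missing)%N; rewrite big_pred0_eq; apply.
  by move=> r; have := a_bnd r; have := ab_sum r; rewrite -/y_missing; lia.
have xy_bound : (k * (h - (x_missing + y_missing)) <= x_small + y_small)%N.
  apply: bound => r.
  by have := ab_sum r; rewrite -/x_missing -/y_missing; lia.
have XE : (\sum_(i < n) minn (u (lshift m i)) k = x_small + k * x_missing)%N.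
  exact: sum_minn.
have YE : (\sum_(i < m) minn (u (rshift n i)) k = y_small + k * y_missing)%N.
  exact: sum_minn.
have [|||//|e [sqe xe me le_eu]] := @sum_of_bases n m k h A B u k1 AB.
- by rewrite XE; nia.
- by rewrite YE; nia.
- by rewrite XE YE; nia.
apply: (monomial_ideal_pow _ le_eu) => j.
have /andP[Axe xeB] := xe j.
have lt_r : (xdeg (e j) - A < s.+1)%N by move: xeB; rewrite /B (aE ord_max) /= /A; lia.
have ar : xdeg (e j) = a (Ordinal lt_r) by rewrite (aE (Ordinal lt_r)) /= -/A; lia.
apply: (@monomial_veronese_sum K n m _ a b (Ordinal lt_r)) => //.
by have := me j; rewrite mdegDxy -(ab_sum (Ordinal lt_r)) -ar => /addnI.
Qed.
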